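(* Let $G$ be a perfect graph whose edges are colored with two colors. Then $V(G)$ can be covered by the vertex sets of $\alpha(G)$ monochromatic subgraphs of $G$, each of diameter at most $3$.
   Context: Graphs are finite and simple; $\alpha(G)$ is the independence number. A graph $G$ is perfect if every induced subgraph $H$ of $G$ satisfies $\omega(H)=\chi(H)$, where $\omega$ is the clique number and $\chi$ the chromatic number. A monochromatic subgraph is a subgraph (not necessarily induced) all of whose edges have the same color; a single vertex counts as a monochromatic subgraph. Different subgraphs in a cover may have different colors and may overlap. The diameter of a graph $H$ is the smallest integer $d$ with $d_H(u,v)\le d$ for all $u,v\in V(H)$, where distances are measured in $H$ itself ($\infty$ if there is no path); a one-vertex graph has diameter $0$. *)

(* Defs.v *)
From mathcomp Require Import all_boot.

Set Implicit Arguments.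
Unset Strict Implicit.
Unset Printing Implicit Defensive.

(* The vertex set is a subset of an ambient finType, so that a graph and its
   subgraphs all live in the same type. *)
Record sgraph (T : finType) := SGraph {
  vset : {set T};
  edge : rel T;
  edge_sym : symmetric edge;
  edge_irr : irreflexive edge;
  edge_vset : forall x y, edge x y -> x \in vset (* hence y \in vset too *)
}.

Section Graphs.
Variable T : finType.
Implicit Types (G H : sgraph T) (A : {set T}).

Definition induced_edge G A : rel T :=
  fun x y => [&& x \in A, y \in A & edge G x y].

Lemma induced_edge_sym G A : symmetric (induced_edge G A).
Proof. by move=> x y; rewrite /induced_edge edge_sym andbCA. Qed.

Lemma induced_edge_irr G A : irreflexive (induced_edge G A).
Proof. by move=> x; rewrite /induced_edge edge_irr !andbF. Qed.

Lemma induced_edge_vset G A x y :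
  induced_edge G A x y -> x \in vset G :&: A.
Proof. by case/and3P=> xA _ /edge_vset xG; rewrite inE xG. Qed.

Definition induced G A : sgraph T :=
  SGraph (induced_edge_sym G A) (induced_edge_irr G A)
         (@induced_edge_vset G A).

Definition subgraph H G : Prop :=
  vset H \subset vset G /\ subrel (edge H) (edge G).

Definition clique G A : bool :=
  (A \subset vset G) && [forall x in A, forall y in A, (x != y) ==> edge G x y].

Definition stable G A : bool :=
  (A \subset vset G) && [forall x in A, forall y in A, ~~ edge G x y].

Definition omega G : nat := \max_(A : {set T} | clique G A) #|A|.

Definition alpha G : nat := \max_(A : {set T} | stable G A) #|A|.

Definition proper_coloring G (f : {ffun T -> T}) : bool :=
  [forall x, forall y, edge G x y ==> (f x != f y)].

(* At most #|vset G| colors are ever needed, so colors may be drawn from T;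
   only the colors used on vset G are counted.  The identity is a proper
   coloring, hence the default value #|T| does not affect the minimum. *)
Definition chi G : nat :=
  \big[minn/#|T|]_(f : {ffun T -> T} | proper_coloring G f) #|f @: vset G|.

Definition perfect G : Prop :=
  forall A, A \subset vset G -> omega (induced G A) = chi (induced G A).

Definition least (P : nat -> Prop) (n : nat) : Prop :=
  P n /\ forall m, P m -> n <= m.

Definition walk H (u v : T) (k : nat) : Prop :=
  exists p : seq T, [/\ path (edge H) u p, last u p = v & size p = k].

(* These are relations since the values may be infinite: no k satisfies
   [is_distance H u v k] when v is not reachable from u, and no d satisfies
   [is_diameter H d] when H is disconnected. *)
Definition is_distance H (u v : T) (k : nat) : Prop := least (walk H u v) k.

Definition is_diameter H (d : nat) : Prop :=
  least (fun d => forall u v, u \in vset H -> v \in vset H ->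
           exists2 k, is_distance H u v k & k <= d) d.

(* An edge coloring is a function of the unordered pair [set x; y]; its values
   on sets that are not edges are irrelevant. *)
Definition monochromatic (c : {set T} -> bool) H : Prop :=
  exists b : bool, forall x y, edge H x y -> c [set x; y] = b.

End Graphs.

(* Main.v *)
Require Import Defs.
From mathcomp Require Import all_boot.
From mathcomp Require Import zify.

Set Implicit Arguments.
Unset Strict Implicit.
Unset Printing Implicit Defensive.

(** A perfect graph is covered by alpha(G) cliques (Lovász's weak perfect graph
    theorem), and in a 2-colored clique one color class has diameter at most 3:
    if u, v are not joined by a red walk of length at most 2, then uv is blue
    and every vertex is blue-adjacent to u or to v.

    For the clique cover, one shows that every weight w on the vertices with
    all cliques of weight at most k is dominated by a sum of k stable sets.
    This replaces Lovász's replication lemma, a weight w(x) standing for w(x)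
    pairwise adjacent copies of x.  If each clique K missed some stable set S_K
    of maximum size a in A, then weighting x by the number of K with x in S_K
    would give every clique weight less than the number N of cliques, and the
    total weight N * a would be at most (N - 1) * a.  So some clique meets all
    maximum stable sets of A; remove it and induct. *)

(** * Cliques, stable sets, counting with multiplicity, optimal colorings *)

Section CliqueCover.
Variables (T : finType) (G : sgraph T).
Implicit Types (A K L S X : {set T}) (s : seq {set T}) (w : T -> nat).

Lemma cliqueP K : reflect (K \subset vset G /\
  forall x y, x \in K -> y \in K -> x != y -> edge G x y) (clique G K).
Proof.
apply: (iffP andP) => -[sKV eK]; split=> //.
  by move=> x y xK yK; move/forall_inP: eK => /(_ x xK) /forall_inP/(_ y yK)/implyP.
by apply/forall_inP => x xK; apply/forall_inP => y yK; apply/implyP; apply: eK.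
Qed.

Lemma stableP S : reflect (S \subset vset G /\
  forall x y, x \in S -> y \in S -> ~~ edge G x y) (stable G S).
Proof.
apply: (iffP andP) => -[sSV eS]; split=> //.
  by move=> x y xS yS; move/forall_inP: eS => /(_ x xS) /forall_inP; apply.
by apply/forall_inP => x xS; apply/forall_inP => y yS; apply: eS.
Qed.

Lemma clique_subset K L : L \subset K -> clique G K -> clique G L.
Proof.
move=> sLK /cliqueP[sKV eK]; apply/cliqueP; split; first exact: subset_trans sKV.
by move=> x y /(subsetP sLK) xK /(subsetP sLK) yK; apply: eK.
Qed.

Lemma stable_subset S X : X \subset S -> stable G S -> stable G X.
Proof.
move=> sXS /stableP[sSV eS]; apply/stableP; split; first exact: subset_trans sSV.
by move=> x y /(subsetP sXS) xS /(subsetP sXS) yS; apply: eS.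
Qed.

Lemma stable1 x : x \in vset G -> stable G [set x].
Proof.
move=> xV; apply/stableP; split; first by rewrite sub1set.
by move=> y z /set1P-> /set1P->; rewrite edge_irr.
Qed.

Lemma clique1 x : x \in vset G -> clique G [set x].
Proof.
move=> xV; apply/cliqueP; split; first by rewrite sub1set.
by move=> y z /set1P-> /set1P->; rewrite eqxx.
Qed.

Lemma card_clique_stable K S : clique G K -> stable G S -> #|K :&: S| <= 1.
Proof.
move=> /cliqueP[_ eK] /stableP[_ eS]; apply/card_le1_eqP => x y.
move=> /setIP[xK xS] /setIP[yK yS]; apply/eqP; apply: contraT => nxy.
by have := eS x y xS yS; rewrite eK // 1?eq_sym.
Qed.

(** Covers are lists, so that a stable set used several times counts each time. *)
Definition multiplicity s x := count (fun S : {set T} => x \in S) s.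

Lemma sum_multiplicity s A :
  \sum_(x in A) multiplicity s x = \sum_(S <- s) #|A :&: S|.
Proof.
under eq_bigr do rewrite /multiplicity -sum1_count big_mkcond.
rewrite exchange_big; apply: eq_bigr => S _.
by rewrite -big_mkcondr -sum1_card; apply: eq_bigl => x; rewrite inE.
Qed.

Lemma sum_stable_card_clique K s : clique G K -> all (stable G) s ->
  \sum_(S <- s) #|K :&: S| <= size s.
Proof.
move=> cK /allP ss; rewrite -sum1_size big_seq [leqRHS]big_seq.
by apply: leq_sum => S /ss; apply: card_clique_stable.
Qed.

(** Being an upper bound on the number of colors of some proper coloring is preserved by minima; the
    identity coloring handles the default [#|T|] in [chi]. *)
Lemma optimal_coloring : exists2 f, proper_coloring G f & #|f @: vset G| <= chi G.
Proof.
pose P m := exists2 f, proper_coloring G f & #|f @: vset G| <= m.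
have idP : P #|T|.
  exists (finfun id); last exact: max_card.
  apply/forallP => x; apply/forallP => y; apply/implyP; rewrite !ffunE.
  by apply: contraTneq => ->; rewrite edge_irr.
rewrite -/(P _) /chi; elim/big_ind: _ => // [m n Pm Pn|f pf]; last by exists f.
by rewrite /minn; case: ifP.
Qed.

End CliqueCover.

(** * Stable covers of weights and clique covers in perfect graphs *)

Lemma clique_induced (T : finType) (G : sgraph T) (A K : {set T}) :
  clique (induced G A) K -> clique G K /\ K \subset A.
Proof.
move=> /cliqueP[sK eK]; move: sK; rewrite subsetI => /andP[sKV sKA].
split=> //; apply/cliqueP; split=> // x y xK yK nxy.
by case/and3P: (eK x y xK yK nxy).
Qed.

(** The stable sets are the color classes of an optimal coloring of the subgraph induced on [A],
    where [chi] equals [omega], hence is at most [k]. *)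
Lemma perfect_stable_cover (T : finType) (G : sgraph T) (A : {set T}) k :
  perfect G -> A \subset vset G ->
  (forall K, clique G K -> K \subset A -> #|K| <= k) ->
  exists s : seq {set T}, [/\ size s <= k, all (stable G) s
    & forall x, x \in A -> 0 < multiplicity s x].
Proof.
move=> hG sAV hk; have [f pf hf] := optimal_coloring (induced G A).
pose C := f @: A.
exists [seq [set x in A | f x == a] | a <- enum C]; split.
- rewrite size_map -cardE; have vsetA : vset (induced G A) = A by apply/setIidPr.
  rewrite vsetA in hf; apply: leq_trans hf _; rewrite -hG //; apply/bigmax_leqP => K.
  by case/clique_induced; apply: hk.
- apply/allP => _ /mapP[a _ ->]; apply/stableP; split.
    by apply: subset_trans sAV; apply/subsetP => x; rewrite inE => /andP[].
  move=> x y; rewrite !inE => /andP[xA /eqP fx] /andP[yA /eqP fy].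
  apply/negP => exy; move/forallP: pf => /(_ x)/forallP/(_ y)/implyP.
  by rewrite fx fy eqxx => /(_ _)/implyP; rewrite /= /induced_edge xA yA exy => /(_ isT).
- move=> x xA; rewrite -has_count; apply/hasP.
  exists [set y in A | f y == f x]; last by rewrite inE xA eqxx.
  by apply/mapP; exists (f x); rewrite // mem_enum imset_f.
Qed.

(** Induction on the total weight. If no vertex weighs more than 1, color the support; otherwise
    lower one weight and reuse a stable set from the resulting cover. *)
Lemma perfect_weighted_cover (T : finType) (G : sgraph T) (w : T -> nat) k :
  perfect G -> (forall K, clique G K -> \sum_(x in K) w x <= k) ->
  exists s : seq {set T}, [/\ size s <= k, all (stable G) s
    & forall x, x \in vset G -> w x <= multiplicity s x].
Proof.
move=> hG; have [n] := ubnP (\sum_x w x); elim: n w k => // n IHn w k lewn hk.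
have [/existsP[x /andP[xV wx]] | small] :=
  boolP [exists x, (x \in vset G) && (1 < w x)]; last first.
  have [||s [szs ss cs]] := @perfect_stable_cover T G
    [set x in vset G | 0 < w x] k hG.
  - by apply/subsetP => x; rewrite inE => /andP[].
  - move=> K cK sK; apply: leq_trans (hk K cK); rewrite -sum1_card.
    by apply: leq_sum => x /(subsetP sK); rewrite inE => /andP[].
  exists s; split=> // x xV; have [->//|wx] := posnP (w x).
  have := cs x; rewrite inE xV wx => /(_ isT); apply: leq_trans.
  by move: small; rewrite negb_exists => /forallP/(_ x); rewrite xV -leqNgt.
pose w1 y := w y - (y == x).
have sum_w1 (A : {set T}) : x \in A -> \sum_(y in A) w y = (\sum_(y in A) w1 y).+1.
  move=> xA; rewrite (bigD1 x) //= [in RHS](bigD1 x) //= /w1 eqxx -addSn.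
  congr (_ + _); first lia.
  by apply: eq_bigr => y /andP[_ /negPf->]; rewrite subn0.
have sumT_w1 : \sum_y w1 y < n.
  have := sum_w1 setT (in_setT x).
  under eq_bigl do rewrite inE; under [in RHS]eq_bigl do rewrite inE; lia.
have w1_le y : w1 y <= w y by apply: leq_subr.
have [|s [szs ss cs]] := IHn w1 k sumT_w1.
  by move=> K cK; apply: leq_trans (hk K cK); apply: leq_sum.
(* As [w x > 1], the vertex [x] keeps a positive weight in [w1]. *)
have /hasP[X Xs xX] : has (fun S : {set T} => x \in S) s.
  by rewrite has_count; apply: leq_trans (cs x xV); rewrite /w1 eqxx; lia.
have stX : stable G X by move/allP: ss; apply.
have k_gt0 : 0 < k by apply: leq_trans szs; case: s Xs {ss cs}.
(* [X] contributes nothing on [K], so the remaining members of [s], at most [k - 1] of them, already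
   bound the weight. *)
have avoidX K : clique G K -> K :&: X = set0 -> \sum_(y in K) w1 y < k.
  move=> cK KX; apply: leq_trans szs.
  have /perm_size sz_s := perm_to_rem Xs.
  rewrite sz_s /= ltnS.
  have sr : all (stable G) (rem X s) by apply/allP => S /mem_rem; move/allP: ss; apply.
  apply: leq_trans (sum_stable_card_clique cK sr).
  have -> : \sum_(S <- rem X s) #|K :&: S| = \sum_(S <- s) #|K :&: S|.
    by rewrite [RHS](perm_big _ (perm_to_rem Xs)) big_cons KX cards0.
  rewrite -sum_multiplicity.
  by apply: leq_sum => y yK; apply: cs; case/cliqueP: cK => /subsetP/(_ y yK).
(* Cover w1 + 1_x by X together with a cover of w2 = w1 - 1_(X \ x): a clique K
   of w1-weight k misses x, as otherwise its w-weight would be k + 1, and meets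
   X in a vertex of positive w1-weight, so its w2-weight drops below k. *)
pose w2 y := w1 y - ((y \in X) && (y != x)).
have w2_le y : w2 y <= w1 y by apply: leq_subr.
have [||r [szr sr cr]] := IHn w2 k.-1.
- by apply: leq_ltn_trans sumT_w1; apply: leq_sum.
- move=> K cK; rewrite -ltnS prednK //.
  have le21 : \sum_(y in K) w2 y <= \sum_(y in K) w1 y by apply: leq_sum.
  have [xK | xK] := boolP (x \in K).
    by apply: leq_ltn_trans le21 _; rewrite -sum_w1 ?hk.
  have [KX | [y]] := set_0Vmem (K :&: X); first exact: leq_ltn_trans (avoidX K cK KX).
  move=> /setIP[yK yX].
  have nyx : y != x by apply: contraNneq xK => <-.
  have w2y : w2 y = (w1 y).-1 by rewrite /w2 yX nyx subn1.
  (* If [y] has weight 0, dropping it keeps the weight of [K]; since [K] meets [X] only in [y], what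
     is left is a clique avoiding [X]. *)
  have [w1y | w1y] := posnP (w1 y).
    have sumD1 : \sum_(z in K) w1 z = \sum_(z in K :\ y) w1 z.
      by rewrite (big_setD1 y) //= w1y.
    apply: leq_ltn_trans le21 _; rewrite sumD1; apply: avoidX.
      by apply: clique_subset cK; apply: subsetDl.
    apply/setP => z; rewrite !inE; apply/negP => /andP[/andP[nzy zK] zX].
    have /card_le1_eqP/(_ y z) := card_clique_stable cK stX.
    by rewrite !inE yK yX zK zX => /(_ isT isT) eyz; rewrite eyz eqxx in nzy.
  have le1k : \sum_(z in K) w1 z <= k by apply: leq_trans (hk K cK); apply: leq_sum.
  apply: leq_trans le1k; rewrite (big_setD1 y) //= [leqRHS](big_setD1 y) //= w2y.
  have : \sum_(z in K :\ y) w2 z <= \sum_(z in K :\ y) w1 z by apply: leq_sum.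
  lia.
exists (X :: r); split=> /=; [lia | by rewrite stX |].
move=> y yV; have := cr y yV; rewrite /multiplicity /= /w2 /w1.
have [->|_] := eqVneq y x; first by rewrite xX /=; lia.
by case: (y \in X) => /=; lia.
Qed.

(** The bound [n.+1] need not be attained: if it is not, any clique will do. This lets the clique
    cover be built by induction on a mere upper bound. *)
Lemma clique_meeting_stable_sets (T : finType) (G : sgraph T) (A : {set T}) n :
  perfect G -> A \subset vset G ->
  (forall S, stable G S -> S \subset A -> #|S| <= n.+1) ->
  exists2 K, clique G K & forall S, stable G S -> S \subset A -> #|S| = n.+1 ->
    K :&: S != set0.
Proof.
move=> hG sAV hn.
pose missed K S := [&& stable G S, S \subset A, #|S| == n.+1 & K :&: S == set0].
have [/existsP[K /andP[cK /existsPn noS]] | noK] :=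
  boolP [exists K, clique G K && ~~ [exists S, missed K S]].
  exists K => // S sS sSA /eqP cS; have := noS S.
  by rewrite /missed sS sSA cS.
(* The default [set0] is never taken at a clique, by [noK]. *)
pose F K := odflt set0 [pick S | missed K S].
have FP K : clique G K -> missed K (F K).
  move=> cK; rewrite /F; case: pickP => //= noS.
  move/existsPn/(_ K): noK; rewrite cK negbK => /existsP[S].
  by rewrite noS.
pose N := #|[set K | clique G K]|.
pose w x := \sum_(K | clique G K) (x \in F K).
have sum_w (B : {set T}) : \sum_(x in B) w x = \sum_(K | clique G K) #|B :&: F K|.
  rewrite exchange_big; apply: eq_bigr => K _.
  rewrite -sum1_card; under [RHS]eq_bigl do rewrite inE.
  by rewrite big_mkcondr; apply: eq_bigr => x _; case: (x \in _).
(* The empty clique ensures that [N.-1] is strictly below [N]. *)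
have clique0 : clique G set0.
  by apply/cliqueP; split=> [|x y]; rewrite ?sub0set ?inE.
have N_gt0 : 0 < N by apply/card_gt0P; exists set0; rewrite inE.
(* A clique [K] gets nothing from its own [F K] and at most 1 from each of the [N.-1] other chosen
   sets. *)
have [|s [szs ss cs]] := @perfect_weighted_cover T G w N.-1 hG.
  move=> K cK; rewrite sum_w (bigD1 K) //=.
  have /and4P[_ _ _ /eqP->] := FP K cK; rewrite cards0 add0n.
  have -> : N.-1 = \sum_(L | clique G L && (L != K)) 1.
    by rewrite /N -sum1_card (bigD1 K) ?inE //=; apply: eq_bigl => L; rewrite inE.
  apply: leq_sum => L /andP[cL _]; apply: card_clique_stable cK _.
  by case/and4P: (FP L cL).
(* Double counting: the weight of [A] is [N * n.+1], but the cover provides at most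
   [N.-1 * n.+1]. *)
have : \sum_(x in A) w x <= \sum_(x in A) multiplicity s x.
  by apply: leq_sum => x /(subsetP sAV); apply: cs.
rewrite sum_multiplicity sum_w.
have -> : \sum_(K | clique G K) #|A :&: F K| = N * n.+1.
  rewrite /N -sum_nat_const; apply: eq_big => [K|K cK]; first by rewrite inE.
  by have /and4P[_ /setIidPr-> /eqP->] := FP K cK.
have le_s : \sum_(S <- s) #|A :&: S| <= size s * n.+1.
  rewrite -sum1_size big_distrl /= big_seq [leqRHS]big_seq.
  apply: leq_sum => S Ss; rewrite mul1n; apply: hn; last exact: subsetIl.
  by apply: stable_subset (allP ss S Ss); apply: subsetIr.
by move=> /leq_trans/(_ le_s); rewrite leq_pmul2r //; lia.
Qed.

(** Induction on [n], shrinking [A] inside a fixed [G]: a stable set of size [n.+1] in [A :\: K]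
    would miss the clique [K] that meets all of them. *)
Lemma perfect_clique_cover (T : finType) (G : sgraph T) (A : {set T}) n :
  perfect G -> A \subset vset G ->
  (forall S, stable G S -> S \subset A -> #|S| <= n) ->
  exists s : seq {set T}, [/\ size s <= n, all (clique G) s
    & forall x, x \in A -> exists2 K, K \in s & x \in K].
Proof.
move=> hG; elim: n A => [|n IHn] A sAV hn.
  exists [::]; split=> // x xA.
  by have := hn _ (stable1 (subsetP sAV x xA)); rewrite sub1set cards1 => /(_ xA).
have [K cK meetK] := clique_meeting_stable_sets hG sAV hn.
have [||s [szs cs covs]] := IHn (A :\: K).
- by apply: subset_trans sAV; apply: subsetDl.
- move=> S sS; rewrite subsetD => /andP[sSA dSK].
  have := hn S sS sSA; rewrite leq_eqVlt => /predU1P[cS|//].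
  by case/eqP: (meetK S sS sSA cS); rewrite setIC; apply/disjoint_setI0.
exists (K :: s); split=> //=; first by rewrite cK.
move=> x xA; have [xK | xK] := boolP (x \in K).
  by exists K; rewrite ?mem_head.
have [|L Ls xL] := covs x; first by rewrite inE xK.
by exists L; rewrite // inE Ls orbT.
Qed.

(** * Distances and diameters as least values *)

Lemma least_exists (P : nat -> Prop) (p : pred nat) n :
  (forall m, reflect (P m) (p m)) -> P n -> exists2 m, least P m & m <= n.
Proof.
move=> Pp Pn; have ex : exists m, p m by exists n; apply/Pp.
exists (ex_minn ex); case: ex_minnP => m /Pp Pm min_m; last exact/min_m/Pp.
by split=> // j /Pp; apply: min_m.
Qed.

Section Diameter.
Variables (T : finType) (H : sgraph T).

(** Tuples of length [k] form a finite type, which makes walks of given length decidable and the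
    least values computable. *)
Definition walkb u v k := [exists p : k.-tuple T, path (edge H) u p && (last u p == v)].

Lemma walkP u v k : reflect (walk H u v k) (walkb u v k).
Proof.
apply: (iffP existsP) => [[p /andP[up /eqP lp]]|[p [up lp /eqP szp]]].
  by exists p; rewrite size_tuple.
by exists (Tuple szp); rewrite /= up lp eqxx.
Qed.

Lemma distance_leP u v d :
  reflect (exists2 k, is_distance H u v k & k <= d) [exists k : 'I_d.+1, walkb u v k].
Proof.
apply: (iffP existsP) => [[k /walkP wk]|[k [/walkP wk _] lekd]].
  have [m dm lemk] := least_exists (walkP u v) wk.
  by exists m; rewrite // (leq_trans lemk) // -ltnS.
by exists (Ordinal (lekd : k < d.+1)).
Qed.

(** Short walks suffice to bound the diameter; they need not be shortest. *)
Lemma diameter_exists d :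
  (forall u v, u \in vset H -> v \in vset H -> exists2 k, walk H u v k & k <= d) ->
  exists2 d', is_diameter H d' & d' <= d.
Proof.
move=> hd; apply: (@least_exists _ (fun d =>
  [forall u in vset H, forall v in vset H, exists k : 'I_d.+1, walkb u v k])).
  move=> m; apply: (iffP forall_inP) => hm u.
    by move=> v uH vH; apply/distance_leP; move/forall_inP: (hm u uH); apply.
  by move=> uH; apply/forall_inP => v vH; apply/distance_leP/hm.
move=> u v uH vH; have [k wk lekd] := hd u v uH vH.
by apply/distance_leP/existsP; exists (Ordinal (lekd : k < d.+1)); apply/walkP.
Qed.

End Diameter.

(** * The two color classes of a clique *)

Section ColoredClique.
Variables (T : finType) (G : sgraph T) (c : {set T} -> bool).

Definition color_edge (K : {set T}) b : rel T :=
  fun x y => induced_edge G K x y && (c [set x; y] == b).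

Lemma color_edge_sym K b : symmetric (color_edge K b).
Proof. by move=> x y; rewrite /color_edge induced_edge_sym setUC. Qed.

Lemma color_edge_irr K b : irreflexive (color_edge K b).
Proof. by move=> x; rewrite /color_edge induced_edge_irr. Qed.

Lemma color_edge_vset K b x y : color_edge K b x y -> x \in vset G :&: K.
Proof. by case/andP=> /induced_edge_vset. Qed.

Definition color_graph K b : sgraph T :=
  SGraph (@color_edge_sym K b) (@color_edge_irr K b) (@color_edge_vset K b).

Lemma color_graph_subgraph K b : subgraph (color_graph K b) G.
Proof. by split=> [|x y /andP[/and3P[]]//]; apply: subsetIl. Qed.

Lemma color_graph_monochromatic K b : monochromatic c (color_graph K b).
Proof. by exists b => x y /andP[_ /eqP]. Qed.

(** The reflexive closure spares case distinctions when vertices coincide. *)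
Definition near (e : rel T) x y := (x == y) || e x y.

Lemma clique_diameter_le3 K : clique G K ->
  exists b, exists2 d, is_diameter (color_graph K b) d & d <= 3.
Proof.
move=> /cliqueP[sKV eK].
have near_walk b x y : near (color_edge K b) x y ->
    exists2 k, walk (color_graph K b) x y k & k <= 1.
  case/predU1P=> [->|exy]; first by exists 0 => //; exists [::].
  by exists 1 => //; exists [:: y]; rewrite /= exy.
have walk_cat b x y z i j : walk (color_graph K b) x y i ->
    walk (color_graph K b) y z j -> walk (color_graph K b) x z (i + j).
  move=> [p [xp lp <-]] [q [yq lq <-]]; exists (p ++ q).
  by rewrite cat_path last_cat size_cat lp xp yq.
have near_color b x y : x \in K -> y \in K ->
    ~~ near (color_edge K b) x y -> near (color_edge K (~~ b)) x y.
  move=> xK yK; rewrite /near /color_edge /induced_edge xK yK /=.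
  by have [//|nxy] := eqVneq x y; rewrite eK //=; case: (c _); case: b.
have near_sym b x y : near (color_edge K b) x y = near (color_edge K b) y x.
  by rewrite /near eq_sym color_edge_sym.
(* Red is [true]; [close] means joined by a red walk of length at most 2. *)
pose close u v := [exists z in K, near (color_edge K true) u z &&
                                  near (color_edge K true) z v].
have [/forall_inP red2 | ] := boolP [forall u in K, forall v in K, close u v].
  exists true; apply: diameter_exists => u v /setIP[_ uK] /setIP[_ vK].
  have /exists_inP[z _ /andP[/near_walk[i wi lei] /near_walk[j wj lej]]] :=
    forall_inP (red2 u uK) v vK.
  by exists (i + j); [apply: walk_cat wi wj | lia].
case/forall_inPn=> u uK /forall_inPn[v vK nuv].
(* A [z] blue-near neither [u] nor [v] would be the middle of a red walk between them. *)
have away z : z \in K -> near (color_edge K false) z u || near (color_edge K false) z v.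
  move=> zK; apply: contraR nuv; rewrite negb_or => /andP[zu zv].
  apply/exists_inP; exists z => //; rewrite near_sym.
  by apply/andP; split; apply: (@near_color false).
have uv : near (color_edge K false) u v.
  apply: (@near_color true) => //; apply: contra nuv => uv.
  by apply/exists_inP; exists v; rewrite // uv /near eqxx.
have near3 x y z t : near (color_edge K false) x y -> near (color_edge K false) y z ->
    near (color_edge K false) z t -> exists2 k, walk (color_graph K false) x t k & k <= 3.
  move=> /near_walk[i wi lei] /near_walk[j wj lej] /near_walk[k wk lek].
  by exists (i + j + k); [exact: walk_cat (walk_cat _ _ _ _ _ _ wi wj) wk | lia].
exists false; apply: diameter_exists => x y /setIP[_ xK] /setIP[_ yK].
have refl z : near (color_edge K false) z z by rewrite /near eqxx.
(* Walk from [x] to [u] or [v], cross the edge [uv] if the ends differ, then go on to [y]. *)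
case/orP: (away x xK) => xs; case/orP: (away y yK); rewrite near_sym => ys.
- exact: near3 xs (refl u) ys.
- exact: near3 xs uv ys.
- by apply: near3 xs _ ys; rewrite near_sym.
- exact: near3 xs (refl v) ys.
Qed.

End ColoredClique.

(** * From the clique cover to exactly [alpha G] subgraphs *)

Unset Implicit Arguments.

Theorem proposition1p3 (T : finType) (G : sgraph T) (c : {set T} -> bool)
  (hG : perfect G) :
  exists H : 'I_(alpha G) -> sgraph T,
    (forall i : 'I_(alpha G),
       [/\ subgraph (H i) G, vset (H i) != set0, monochromatic c (H i)
         & exists2 d : nat, is_diameter (H i) d & d <= 3])
    /\ vset G \subset \bigcup_(i < alpha G) vset (H i).
Proof.
have stable_alpha S : stable G S -> S \subset vset G -> #|S| <= alpha G.
  by move=> sS _; apply: leq_bigmax_cond.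
have [s [szs cs covs]] := perfect_clique_cover hG (subxx _) stable_alpha.
(* Padding requires a vertex; without one, [alpha G] is 0 and the family is empty. *)
have [V0 | [v0 v0V]] := set_0Vmem (vset G).
  have a0 : alpha G = 0.
    apply/eqP; rewrite -leqn0; apply/bigmax_leqP => S /andP[+ _].
    by rewrite V0 subset0 => /eqP->; rewrite cards0.
  exists (fun=> G); split; last by rewrite V0 sub0set.
  by move=> i; have := ltn_ord i; rewrite {2}a0.
(* The cover may be shorter than [alpha G] or contain empty cliques; [[set v0]] replaces both kinds
   of gap. *)
pose K (i : nat) := if nth set0 s i == set0 then [set v0] else nth set0 s i.
have clK i : clique G (K i).
  rewrite /K; case: eqP => [_|ne]; first exact: clique1.
  have [lt|ge] := ltnP i (size s); first by apply: (allP cs); rewrite mem_nth.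
  by case: ne; rewrite nth_default.
have K_neq0 i : K i != set0.
  by rewrite /K; case: ifPn => // _; apply/set0Pn; exists v0; rewrite inE.
pose mono i (b : bool) := exists2 d, is_diameter (color_graph G c (K i) b) d & d <= 3.
have [b hb] : exists b : 'I_(alpha G) -> bool, forall i : 'I_(alpha G), mono i (b i).
  apply: (@fin_all_exists _ _ (fun i : 'I_(alpha G) => mono i)).
  by move=> i; apply: clique_diameter_le3.
have vsetK i b' : vset (color_graph G c (K i) b') = K i.
  by apply/setIidPr; case/cliqueP: (clK i).
exists (fun i : 'I_(alpha G) => color_graph G c (K i) (b i)); split=> [i|].
  split; [exact: color_graph_subgraph | by rewrite vsetK
         | exact: color_graph_monochromatic | exact: hb].
apply/subsetP => x xV; have [L Ls xL] := covs x xV.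
(* [L] contains [x], so [K] leaves it unchanged at its index. *)
have lti : index L s < alpha G by apply: leq_trans szs; rewrite index_mem.
apply/bigcupP; exists (Ordinal lti) => //; rewrite vsetK /K /= nth_index //.
by case: eqP => [L0|//]; rewrite L0 inE in xL.
Qed.
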